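(* The polynomials that are both Demazure atoms and Young atoms are precisely the $\hat{\mathcal A}_a$ such that $|a_i-a_{i+1}|\le 1$ for all $1\le i < n$.
   Context: Weak compositions $a$ have length $n$. The Demazure atom is $\mathcal A_a=\overline{\pi}_{w_a}x^{\mathrm{sort}(a)}$, where $\overline\pi_i=\pi_i-1$, $\pi_i f=\partial_i(x_if)$, $\partial_i f=(f-s_if)/(x_i-x_{i+1})$, $\mathrm{sort}(a)$ is the weakly decreasing rearrangement of $a$, and $w_a$ is the minimal length permutation sending $a$ to $\mathrm{sort}(a)$. The Young atom is $\hat{\mathcal A}_a(x_1,\ldots,x_n)=\mathcal A_{\mathrm{rev}(a)}(x_n,\ldots,x_1)$, $\mathrm{rev}(a)$ being $a$ reversed; equivalently it is the generating function of fillings of the diagram of $a$ (row $i$ has $a_i$ left-justified boxes) with entries in $\{1,\ldots,n\}$, rows weakly increasing, no repeated entry in a column, first entry of row $i$ equal to $i$, and all Young triples being Young inversion triples. *)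

(* Defs.v *)
From HB Require Import structures.
From mathcomp Require Import all_boot all_order all_algebra all_fingroup.
From mathcomp Require Import mpoly.

Set Implicit Arguments.
Unset Strict Implicit.
Unset Printing Implicit Defensive.

Import GRing.Theory.
Local Open Scope ring_scope.

(* Positions and variables are numbered from 0, so [i : 'I_n.-1] stands for an
   index 1 <= i < n; [lo i] and [hi i] are the positions "i" and "i+1". *)
Definition lo (n : nat) (i : 'I_n.-1) : 'I_n := widen_ord (leq_pred n) i.

Lemma hi_subproof (n : nat) (i : 'I_n.-1) : (i.+1 < n)%N.
Proof. by rewrite -ltn_predRL. Qed.

Definition hi (n : nat) (i : 'I_n.-1) : 'I_n := Ordinal (hi_subproof i).

Definition simple (n : nat) (i : 'I_n.-1) : 'S_n := tperm (lo i) (hi i).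

Lemma lo_neq_hi (n : nat) (i : 'I_n.-1) : lo i != hi i.
Proof. by rewrite -val_eqE /= neq_ltn ltnSn. Qed.

Lemma divdiff_ex (n : nat) (i : 'I_n.-1) (f : {mpoly int[n]}) :
  exists g : {mpoly int[n]},
    ('X_(lo i) - 'X_(hi i)) * g == f - msym (simple i) f.
Proof.
pose P (f : {mpoly int[n]}) := exists g : {mpoly int[n]},
  ('X_(lo i) - 'X_(hi i)) * g = f - msym (simple i) f.
have P1 : P 1 by exists 0; rewrite msym1 subrr mulr0.
have PM (p q : {mpoly int[n]}) : P p -> P q -> P (p * q).
  move=> [g Hg] [h Hh]; exists (g * q + msym (simple i) p * h).
  rewrite mulrDr mulrA Hg mulrCA Hh msymM mulrBl mulrBr.
  by rewrite addrA subrK.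
have PX k : P 'X_k.
  rewrite /P /msym mmapX mmap1U.
  rewrite /simple; case: tpermP => [->|->|_ _].
  - by exists 1; rewrite mulr1.
  - by exists (-1); rewrite mulrN1 opprB.
  - by exists 0; rewrite mulr0 subrr.
suff [g Hg] : P f by exists g; apply/eqP.
elim/mpolyind: f => [|c m p _ _ [h Hh]].
  by exists 0; rewrite msym0 subrr mulr0.
have [g Hg] : P 'X_[m].
  rewrite mpolyXE_id; apply: big_ind => // k _.
  by elim: (m k) => [|e IH]; rewrite ?expr0 // exprS; apply: PM.
exists (c *: g + h).
by rewrite mulrDr -scalerAr Hg Hh msymD msymZ scalerBr addrACA -opprD.
Qed.

(* The quotient (f - s_i f) / (x_i - x_{i+1}), which is unique since
   {mpoly int[n]} is an integral domain. *)
Definition divdiff (n : nat) (i : 'I_n.-1) (f : {mpoly int[n]}) :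
  {mpoly int[n]} := xchoose (divdiff_ex i f).

Definition isobaric (n : nat) (i : 'I_n.-1) (f : {mpoly int[n]}) :
  {mpoly int[n]} := divdiff i ('X_(lo i) * f).

Definition isobaric_bar (n : nat) (i : 'I_n.-1) (f : {mpoly int[n]}) :
  {mpoly int[n]} := isobaric i f - f.

(* [s * t] in 'S_n applies s first: the word i_1 ... i_k denotes the permutation
   applying s_{i_1} first, then s_{i_2}, and so on. *)
Definition word_perm (n : nat) (s : seq 'I_n.-1) : 'S_n :=
  (\prod_(i <- s) simple i)%g.

Lemma word_ex (n : nat) (w : 'S_n) :
  exists k, [exists s : k.-tuple 'I_n.-1, word_perm s == w].
Proof.
suff [s <-] : exists s, word_perm s = w.
  by exists (size s); apply/existsP; exists (in_tuple s).
have Pcat (s t : seq 'I_n.-1) :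
    word_perm (s ++ t) = (word_perm s * word_perm t)%g.
  by rewrite /word_perm big_cat.
have Plt d : forall x y : 'I_n, (y = x + d.+1 :> nat)%N ->
    exists s, word_perm s = tperm x y.
  elim: d => [|d IH] x y Exy.
    have ltx : (x < n.-1)%N by rewrite ltn_predRL -[x.+1]addn1 -Exy.
    exists [:: Ordinal ltx]; rewrite /word_perm big_seq1 /simple.
    by congr tperm; apply: val_inj; rewrite //= Exy addn1.
  have ltk : (x + d.+1 < n.-1)%N by rewrite ltn_predRL -[(x + _).+1]addnS -Exy.
  pose k := Ordinal ltk; have [s Es] := IH x (lo k) erefl.
  exists ([:: k] ++ s ++ [:: k]); rewrite !Pcat Es /word_perm big_seq1.
  have -> : y = hi k by apply: val_inj; rewrite /= Exy addnS.
  have -> : (simple k * (tperm x (lo k) * simple k) =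
             tperm x (lo k) ^ simple k)%g by rewrite conjgE tpermV.
  rewrite tpermJ /simple tpermL tpermD // -val_eqE /= -?addnS.
    by rewrite -[X in _ != X]addn0 eqn_add2l.
  by rewrite -[X in _ != X]addn0 eqn_add2l.
have Ptp (x y : 'I_n) : exists s, word_perm s = tperm x y.
  have [ltxy|ltyx|/val_inj ->] := ltngtP x y.
  - by apply: (Plt (y - x).-1); rewrite prednK ?subn_gt0 // subnKC // ltnW.
  - rewrite tpermC; apply: (Plt (x - y).-1).
    by rewrite prednK ?subn_gt0 // subnKC // ltnW.
  - by exists [::]; rewrite tperm1 /word_perm big_nil.
have [ts -> _] := prod_tpermP w.
apply: (big_ind (fun v : 'S_n => exists s, word_perm s = v)) => //.
- by exists [::]; rewrite /word_perm big_nil.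
- by move=> _ _ [s <-] [t <-]; exists (s ++ t).
Qed.

Definition perm_length (n : nat) (w : 'S_n) : nat := ex_minn (word_ex w).

Lemma reduced_word_ex (n : nat) (w : 'S_n) :
  exists s : seq 'I_n.-1, (word_perm s == w) && (size s == perm_length w).
Proof.
rewrite /perm_length; case: ex_minnP => k /existsP[s Es] _.
by exists s; rewrite Es size_tuple eqxx.
Qed.

(* The operators satisfy the braid relations, so the choice of a reduced word
   in [isobaric_bar_perm] is immaterial. *)
Definition reduced_word (n : nat) (w : 'S_n) : seq 'I_n.-1 :=
  xchoose (reduced_word_ex w).

(* isobaric_bar i_1 (... (isobaric_bar i_k f)) for a reduced word i_1 ... i_k *)
Definition isobaric_bar_perm (n : nat) (w : 'S_n) (f : {mpoly int[n]}) :
  {mpoly int[n]} := foldr (@isobaric_bar n) f (reduced_word w).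

Definition sort_comp (n : nat) (a : n.-tuple nat) : n.-tuple nat :=
  [tuple of sort geq a].

Definition rev_comp (n : nat) (a : n.-tuple nat) : n.-tuple nat :=
  [tuple of rev a].

(* w moves the entry of a in position i to position w i of sort(a).  With the
   product of 'S_n, a word i_1 ... i_k of w then turns a into sort(a) by
   exchanging the entries in positions i_1, i_1 + 1, next those in positions
   i_2, i_2 + 1, and so on; this is the convention for which x^a
   occurs in A_a. *)
Definition sends_to_sort (n : nat) (a : n.-tuple nat) (w : 'S_n) : bool :=
  [forall i, tnth (sort_comp a) (w i) == tnth a i].

Lemma sorting_perm_ex (n : nat) (a : n.-tuple nat) :
  exists w : 'S_n, sends_to_sort a w &&
    [forall v : 'S_n, sends_to_sort a v ==> (perm_length w <= perm_length v)%N].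
Proof.
have /tuple_permP[w0 Ew0] : perm_eq a (sort_comp a).
  by rewrite perm_sym perm_sort.
have Hw0 : sends_to_sort a w0.
  apply/forallP => i; apply/eqP.
  have -> : a = [tuple tnth (sort_comp a) (w0 j) | j < n] by apply: val_inj.
  rewrite tnth_mktuple; congr tnth.
  by apply: val_inj; rewrite /= {1}Ew0.
case: (arg_minnP (@perm_length n) Hw0) => w Hw minw.
by exists w; rewrite Hw; apply/forallP => v; apply/implyP; apply: minw.
Qed.

Definition sorting_perm (n : nat) (a : n.-tuple nat) : 'S_n :=
  xchoose (sorting_perm_ex a).

Definition demazure_atom (n : nat) (a : n.-tuple nat) : {mpoly int[n]} :=
  isobaric_bar_perm (sorting_perm a) 'X_[Multinom (sort_comp a)].

(* the substitution x_i |-> x_{n+1-i} *)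
Definition reverse_vars (n : nat) (f : {mpoly int[n]}) : {mpoly int[n]} :=
  f \mPo [tuple 'X_(rev_ord i) | i < n].

Definition young_atom (n : nat) (a : n.-tuple nat) : {mpoly int[n]} :=
  reverse_vars (demazure_atom (rev_comp a)).

(* Main.v *)
Require Import Defs.
From mathcomp Require Import all_boot all_order all_algebra all_fingroup.
From mathcomp Require Import mpoly.
From mathcomp Require Import zify ring.
Local Open Scope ring_scope.

Set Implicit Arguments.
Unset Strict Implicit.
Unset Printing Implicit Defensive.

Import GRing.Theory.

(** Both sides of the equivalence describe the compositions [a] for which the
    atom of [a] and the atom of the reversal of [a] are the monomial [x^a].

    If [a_i < a_{i+1}] then [A_a] is the image under [isobaric_bar i] of the atom
    of the swapped composition, and such an image is [x_{i+1}] times a polynomial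
    symmetric in [x_i, x_{i+1}]; when [A_a = x^a] this forces
    [a_{i+1} = a_i + 1].  Conversely, if [a] never increases by more than 1, sort
    [a] by repeatedly moving the top of its last ascent to the left, past all the
    smaller entries; following the monomials back shows [A_a = x^a].

    If an atom [A_a] equals a Young atom indexed by [b], then [x^a] and [x^b] are
    both its unique monomial with the largest sum of squares of exponents, so
    [a = b].  The partial sums of the exponents of a monomial of [A_a] are at
    least those of [a], and those of a monomial of the Young atom are at most
    those of [a], so the common atom is [x^a]. *)

(** * Commutation and braid relations of the operators *)

Lemma comm_identity (R : comNzRingType) (x y z w f sf tf stf g h sh tg : R) :
  (x - y) * g = y * (f - sf) -> (z - w) * h = w * (f - tf) ->
  (x - y) * tg = y * (tf - stf) -> (z - w) * sh = w * (sf - stf) ->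
  (z - w) * (y * (h - sh)) = (x - y) * (w * (g - tg)).
Proof.
move=> eg eh etg esh.
have -> : (z - w) * (y * (h - sh)) = y * ((z - w) * h - (z - w) * sh) by ring.
have -> : (x - y) * (w * (g - tg)) = w * ((x - y) * g - (x - y) * tg) by ring.
by rewrite eg eh etg esh; ring.
Qed.

(* [f], [fs], [fts], ... stand for a polynomial and its images under permutations
   of x, y, z, and [g], [h], [k] for its successive images under the operators;
   the right-hand side contains the alternating sum over S_3. *)
Lemma braid_identity (R : comNzRingType)
  (x y z f fs ft fts fst fsts g tg sg stg h sh k : R) :
  (x - y) * g = y * (f - fs) -> (x - z) * tg = z * (ft - fts) ->
  (y - x) * sg = x * (fs - f) -> (y - z) * stg = z * (fst - fsts) ->
  (y - z) * h = z * (g - tg) -> (x - z) * sh = z * (sg - stg) ->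
  (x - y) * k = y * (h - sh) ->
  (x - y) * ((y - z) * ((x - z) * ((x - y) * k))) =
  (x - y) * (y * z * z * (f - fs - ft + fts + fst - fsts)).
Proof.
move=> eg etg esg estg eh esh ek.
have -> : (x - y) * ((y - z) * ((x - z) * ((x - y) * k))) =
  (x - y) * ((y - z) * ((x - z) * (y * (h - sh)))) by rewrite ek.
have -> : (x - y) * ((y - z) * ((x - z) * (y * (h - sh)))) =
  (x - y) * y * ((x - z) * ((y - z) * h) - (y - z) * ((x - z) * sh)) by ring.
rewrite eh esh.
have -> : (x - y) * y * ((x - z) * (z * (g - tg)) - (y - z) * (z * (sg - stg))) =
  y * z * ((x - z) * ((x - y) * g) - (x - y) * ((x - z) * tg)
           + (y - z) * ((y - x) * sg) + (x - y) * ((y - z) * stg)) by ring.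
by rewrite eg etg esg estg; ring.
Qed.

(** The expansion for the other side of the braid relation: when [fsts = ftst], both right-hand
    sides carry the same alternating sum. The repeated outer factor, here and in [braid_identity],
    lets each hypothesis be substituted without division. *)
Lemma braid_identity_rev (R : comNzRingType)
  (x y z f fs ft fts fst ftst g tg sg tsg h th k : R) :
  (y - z) * g = z * (f - ft) -> (x - z) * sg = z * (fs - fst) ->
  (z - y) * tg = y * (ft - f) -> (x - y) * tsg = y * (fts - ftst) ->
  (x - y) * h = y * (g - sg) -> (x - z) * th = z * (tg - tsg) ->
  (y - z) * k = z * (h - th) ->
  (y - z) * ((x - y) * ((x - z) * ((y - z) * k))) =
  (y - z) * (y * z * z * (f - fs - ft + fts + fst - ftst)).
Proof.
move=> eg esg etg etsg eh eth ek.
have -> : (y - z) * ((x - y) * ((x - z) * ((y - z) * k))) =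
  (y - z) * ((x - y) * ((x - z) * (z * (h - th)))) by rewrite ek.
have -> : (y - z) * ((x - y) * ((x - z) * (z * (h - th)))) =
  (y - z) * z * ((x - z) * ((x - y) * h) - (x - y) * ((x - z) * th)) by ring.
rewrite eh eth.
have -> : (y - z) * z * ((x - z) * (y * (g - sg)) - (x - y) * (z * (tg - tsg))) =
  z * ((x - z) * y * ((y - z) * g) - (y - z) * y * ((x - z) * sg)
       + (x - y) * z * ((z - y) * tg) + (y - z) * z * ((x - y) * tsg)) by ring.
by rewrite eg esg etg etsg; ring.
Qed.

Section Operators.
Variable n : nat.
Implicit Types (i j : 'I_n.-1) (f g : {mpoly int[n]}) (m c d : 'X_{1..n}).

Definition mswap i m : 'X_{1..n} := [multinom m (simple i x) | x < n].

Lemma simpleK i : involutive (simple i).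
Proof. exact: tpermK. Qed.

Lemma simpleV i : ((simple i)^-1 = simple i)%g.
Proof. exact: tpermV. Qed.

Lemma simple_other i (x : 'I_n) : x != lo i -> x != hi i -> simple i x = x.
Proof. by move=> xl xh; rewrite /simple tpermD // eq_sym. Qed.

Lemma mswap_lo i m : mswap i m (lo i) = m (hi i).
Proof. by rewrite mnmE tpermL. Qed.

Lemma mswap_hi i m : mswap i m (hi i) = m (lo i).
Proof. by rewrite mnmE tpermR. Qed.

Lemma mswap_other i m x : x != lo i -> x != hi i -> mswap i m x = m x.
Proof. by move=> xl xh; rewrite mnmE simple_other. Qed.

Lemma mswapK i : involutive (mswap i).
Proof. by move=> m; apply/mnmP => x; rewrite !mnmE simpleK. Qed.

Lemma mswap_id i m : m (lo i) = m (hi i) -> mswap i m = m.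
Proof.
move=> e; apply/mnmP => x; rewrite mnmE.
by rewrite /simple; case: tpermP => [->|->|].
Qed.

Lemma msym_simpleK i f : msym (simple i) (msym (simple i) f) = f.
Proof. by rewrite -msymMm tperm2 msym1m. Qed.

Lemma msym_simple_X i m : msym (simple i) 'X_[m] = 'X_[mswap i m] :> {mpoly int[n]}.
Proof. by rewrite msymX simpleV. Qed.

Lemma msym_var (s : 'S_n) k : msym s 'X_k = 'X_(s k) :> {mpoly int[n]}.
Proof. by rewrite /msym mmapX mmap1U. Qed.

Lemma subX_neq0 (x y : 'I_n) : x != y -> 'X_x - 'X_y != 0 :> {mpoly int[n]}.
Proof.
move=> xy; apply/eqP => /(congr1 (mcoeff U_(x)%MM)) /eqP.
by rewrite mcoeffB !mcoeffXU mcoeff0 eqxx (eq_sym y) (negPf xy).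
Qed.

Lemma divdiffE i f : ('X_(lo i) - 'X_(hi i)) * divdiff i f = f - msym (simple i) f.
Proof. by rewrite /divdiff; apply/eqP; apply: (xchooseP (divdiff_ex i f)). Qed.

(** Since x_i f - x_{i+1} s_i f - (x_i - x_{i+1}) f = x_{i+1} (f - s_i f). By [msym_divdiff] the
    second factor is symmetric in the two variables. *)
Lemma isobaric_barE i f : isobaric_bar i f = 'X_(hi i) * divdiff i f.
Proof.
apply: (mulfI (subX_neq0 (lo_neq_hi i))).
rewrite /isobaric_bar /isobaric mulrBr divdiffE mulrCA divdiffE msymM msym_var.
by rewrite tpermL; ring.
Qed.

Lemma isobaric_bar_mul i f : ('X_(lo i) - 'X_(hi i)) * isobaric_bar i f =
  'X_(hi i) * (f - msym (simple i) f).
Proof. by rewrite isobaric_barE mulrCA divdiffE. Qed.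

Lemma msym_divdiff i f : msym (simple i) (divdiff i f) = divdiff i f.
Proof.
apply: (mulfI (subX_neq0 (lo_neq_hi i))).
have := congr1 (msym (simple i)) (divdiffE i f).
rewrite msymM !msymB !msym_var tpermL tpermR msym_simpleK divdiffE => e.
by rewrite -[RHS]opprB -e; ring.
Qed.

Lemma isobaric_barD i : {morph isobaric_bar i : f g / f + g}.
Proof.
move=> f g; apply: (mulfI (subX_neq0 (lo_neq_hi i))).
by rewrite [RHS]mulrDr !isobaric_bar_mul msymD -mulrDr opprD addrACA.
Qed.

Lemma isobaric_barZ i k f : isobaric_bar i (k *: f) = k *: isobaric_bar i f.
Proof.
apply: (mulfI (subX_neq0 (lo_neq_hi i))).
by rewrite -scalerAr !isobaric_bar_mul msymZ -scalerBr -scalerAr.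
Qed.

Lemma isobaric_bar0 i : isobaric_bar i 0 = 0.
Proof.
by have := isobaric_barZ i 0 0; rewrite !scale0r.
Qed.

Lemma isobaric_bar_comm i j f : (i.+1 < j)%N ->
  isobaric_bar i (isobaric_bar j f) = isobaric_bar j (isobaric_bar i f).
Proof.
move=> ij.
have nij : [/\ lo j != lo i, lo j != hi i, hi j != lo i & hi j != hi i].
  by rewrite -!val_eqE /=; split; lia.
case: nij => n1 n2 n3 n4.
apply: (mulfI (subX_neq0 (lo_neq_hi i))); apply: (mulfI (subX_neq0 (lo_neq_hi j))).
rewrite [X in _ * X = _]isobaric_bar_mul [RHS]mulrCA [X in _ = _ * X]isobaric_bar_mul.
have ei := isobaric_bar_mul i f; have ej := isobaric_bar_mul j f.
have := congr1 (msym (simple i)) ej; have := congr1 (msym (simple j)) ei.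
rewrite !msymM !msymB !msym_var.
have -> : simple j (lo i) = lo i by rewrite simple_other // eq_sym.
have -> : simple j (hi i) = hi i by rewrite simple_other // eq_sym.
have -> : simple i (lo j) = lo j by rewrite simple_other.
have -> : simple i (hi j) = hi j by rewrite simple_other.
have -> : msym (simple j) (msym (simple i) f) = msym (simple i) (msym (simple j) f).
  have cij : (simple j ^ simple i = simple j)%g.
    by rewrite {1}/simple tpermJ !simple_other.
  by rewrite -!msymMm [in RHS]conjgC cij.
move=> ei' ej'.
exact: (comm_identity ei ej ei' ej').
Qed.

Lemma isobaric_bar_braid i j f : (j = i.+1 :> nat) ->
  isobaric_bar i (isobaric_bar j (isobaric_bar i f)) =
  isobaric_bar j (isobaric_bar i (isobaric_bar j f)).
Proof.
move=> ij.
have ehi : lo j = hi i by apply: val_inj; rewrite /= ij.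
pose x := lo i; pose y := hi i; pose z := hi j.
have xy : x != y by apply: lo_neq_hi.
have yz : y != z by rewrite /y -ehi; apply: lo_neq_hi.
have xz : x != z by rewrite -val_eqE /= ij; lia.
pose s := simple i; pose t := simple j.
have tE : t = tperm y z by rewrite /t /simple ehi.
have [sx sy sz] : [/\ s x = y, s y = x & s z = z].
  by rewrite /s /simple tpermL tpermR tpermD.
have [tx ty tz] : [/\ t x = x, t y = z & t z = y].
  by rewrite tE tpermL tpermR tpermD // eq_sym.
have sts : (s * t * s = t * s * t)%g.
  have ts : (t ^ s = tperm x z)%g by rewrite tE tpermJ sy sz.
  have st : (s ^ t = tperm x z)%g by rewrite /s /simple tpermJ tx ty.
  have := etrans st (esym ts); rewrite !conjgE {1}tE tpermV -tE simpleV => e.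
  have tt : (t * t = 1)%g by apply: tperm2.
  have ss : (s * s = 1)%g by apply: tperm2.
  by rewrite -mulgA -e !mulgA.
pose S := msym s : {mpoly int[n]} -> _; pose T := msym t : {mpoly int[n]} -> _.
have SX k : S 'X_k = 'X_(s k) by apply: msym_var.
have TX k : T 'X_k = 'X_(t k) by apply: msym_var.
have STS g : S (T (S g)) = T (S (T g)) by rewrite /S /T -!msymMm !mulgA sts.
have bi g : ('X_x - 'X_y) * isobaric_bar i g = 'X_y * (g - S g).
  exact: isobaric_bar_mul.
have bj g : ('X_y - 'X_z) * isobaric_bar j g = 'X_z * (g - T g).
  by have := isobaric_bar_mul j g; rewrite ehi.
have tbi g : ('X_x - 'X_z) * T (isobaric_bar i g) = 'X_z * (T g - T (S g)).
  by have := congr1 T (bi g); rewrite /T !msymM !msymB -/T !TX tx ty.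
have sbi g : ('X_y - 'X_x) * S (isobaric_bar i g) = 'X_x * (S g - g).
  have := congr1 S (bi g); rewrite /S !msymM !msymB msym_simpleK -/S !SX sx sy.
  by [].
have sbj g : ('X_x - 'X_z) * S (isobaric_bar j g) = 'X_z * (S g - S (T g)).
  by have := congr1 S (bj g); rewrite /S !msymM !msymB -/S !SX sy sz.
have tbj g : ('X_z - 'X_y) * T (isobaric_bar j g) = 'X_y * (T g - g).
  have := congr1 T (bj g); rewrite /T !msymM !msymB msym_simpleK -/T !TX ty tz.
  by [].
have stbi g : ('X_y - 'X_z) * S (T (isobaric_bar i g)) = 'X_z * (S (T g) - S (T (S g))).
  by have := congr1 S (tbi g); rewrite /S !msymM !msymB -/S !SX sx sz.
have tsbj g : ('X_x - 'X_y) * T (S (isobaric_bar j g)) = 'X_y * (T (S g) - T (S (T g))).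
  by have := congr1 T (sbj g); rewrite /T !msymM !msymB -/T !TX tx tz.
have L := braid_identity (bi f) (tbi f) (sbi f) (stbi f) (bj _) (sbj _) (bi _).
have R := braid_identity_rev (bj f) (sbj f) (tbj f) (tsbj f) (bi _) (tbi _) (bj _).
(* After multiplication by the three differences, [L] and [R] turn both sides into y z^2 times the
   alternating sum of the images of [f] under S_3. *)
apply: (mulfI (subX_neq0 xz)); apply: (mulfI (subX_neq0 yz)).
apply: (mulfI (subX_neq0 xy)).
move/(mulfI (subX_neq0 xy)): L => L; move/(mulfI (subX_neq0 yz)): R => R.
move: L R; rewrite STS.
set k := isobaric_bar i _; set k' := isobaric_bar j (_ (_ f)).
move: k k' => k k'; move: ('X_x - 'X_y) ('X_y - 'X_z) ('X_x - 'X_z) => a b c L R.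
rewrite [in LHS]mulrCA [a * (c * k)]mulrCA L -R.
by rewrite [in RHS]mulrCA [b * (a * _)]mulrCA [b * (c * _)]mulrCA.
Qed.
End Operators.

(** * Monomials produced by one operator *)

Lemma monomial_shuffle (R : comNzRingType) (a b c d e f : R) :
  a * b * (c * d * e * f) = c * a * (d * (b * (e * f))).
Proof. by ring. Qed.

Lemma binomial_shuffle (R : comNzRingType) (y a b q e p : R) :
  y * (a * q * (e * p) - q * (b * e * p)) = (a - b) * (y * (q * (e * p))).
Proof. by ring. Qed.

Section Support.
Variable n : nat.
Implicit Types (i j : 'I_n.-1) (f g : {mpoly int[n]}) (m c d : 'X_{1..n}).

Definition mset c i p q : 'X_{1..n} :=
  [multinom if x == lo i then p else if x == hi i then q else c x | x < n].

Lemma mset_lo c i p q : mset c i p q (lo i) = p.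
Proof. by rewrite mnmE eqxx. Qed.

Lemma mset_hi c i p q : mset c i p q (hi i) = q.
Proof. by rewrite mnmE eq_sym (negPf (lo_neq_hi i)) eqxx. Qed.

Lemma mset_other c i p q x : x != lo i -> x != hi i -> mset c i p q x = c x.
Proof. by rewrite mnmE => /negPf-> /negPf->. Qed.

Lemma mset_id c i : mset c i (c (lo i)) (c (hi i)) = c.
Proof.
by apply/mnmP => x; rewrite mnmE; case: eqP => [->|_] //; case: eqP => [->|].
Qed.

Lemma mset_swap c i p q : mswap i (mset c i p q) = mset c i q p.
Proof.
apply/mnmP => x; have [->|xl] := eqVneq x (lo i).
  by rewrite mswap_lo mset_lo mset_hi.
have [->|xh] := eqVneq x (hi i); first by rewrite mswap_hi mset_lo mset_hi.
by rewrite mswap_other ?mset_other.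
Qed.

Lemma mset_mswap c i : mset (mswap i c) i (c (lo i)) (c (hi i)) = c.
Proof.
apply/mnmP => x; rewrite mnmE.
case: eqP => [->//|/eqP xl]; case: eqP => [->//|/eqP xh].
by rewrite mswap_other.
Qed.

Lemma big_lo_hi (R : Type) (idx : R) (op : Monoid.com_law idx) i (F : 'I_n -> R) :
  \big[op/idx]_x F x = op (F (lo i)) (op (F (hi i))
    (\big[op/idx]_(x | (x != lo i) && (x != hi i)) F x)).
Proof.
by rewrite (bigD1 (lo i)) //= (bigD1 (hi i)) //= eq_sym lo_neq_hi.
Qed.

Lemma mpolyX_mset c i p q : 'X_[mset c i p q] =
  'X_(lo i) ^+ p * ('X_(hi i) ^+ q *
     \prod_(x | (x != lo i) && (x != hi i)) 'X_x ^+ c x) :> {mpoly int[n]}.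
Proof.
rewrite mpolyXE_id (big_lo_hi _ i) mset_lo mset_hi; congr (_ * (_ * _)).
by apply: eq_bigr => x /andP[xl xh]; rewrite mset_other.
Qed.

(** The quotient of x_i^k - x_{i+1}^k by x_i - x_{i+1} is a geometric sum, and the factor x_{i+1}
    shifts it. For [k > 0] the starting monomial is therefore absent, and its swap is the term
    [l = 0]. *)
Lemma isobaric_bar_mset c i q k : isobaric_bar i 'X_[mset c i (k + q) q] =
  \sum_(l < k) 'X_[mset c i (l + q) (k - l + q)].
Proof.
apply: (mulfI (subX_neq0 (lo_neq_hi i))).
rewrite isobaric_bar_mul msym_simple_X mset_swap !mpolyX_mset.
rewrite [X in _ = _ * X](eq_bigr (fun l : 'I_k =>
  ('X_(hi i) ^+ (k.-1 - l) * 'X_(lo i) ^+ l) * ('X_(hi i) * ('X_(lo i) ^+ q * ('X_(hi i) ^+ q *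
     \prod_(x | (x != lo i) && (x != hi i)) 'X_x ^+ c x))))); last first.
  move=> l _; rewrite mpolyX_mset.
  have -> : (k - l + q = (k.-1 - l) + 1 + q)%N by have := ltn_ord l; lia.
  rewrite !exprD expr1; exact: monomial_shuffle.
rewrite -mulr_suml [RHS]mulrA.
have -> : ('X_(lo i) - 'X_(hi i)) * (\sum_(l < k) 'X_(hi i) ^+ (k.-1 - l) * 'X_(lo i) ^+ l)
   = 'X_(lo i) ^+ k - 'X_(hi i) ^+ k :> {mpoly int[n]}.
  by rewrite -[RHS]opprB subrXX -mulNr opprB.
by rewrite !exprD; apply: binomial_shuffle.
Qed.

Lemma isobaric_bar_mset_neg c i q k : isobaric_bar i 'X_[mset c i q (k + q)] =
  - \sum_(l < k) 'X_[mset c i (l + q) (k - l + q)].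
Proof.
rewrite -isobaric_bar_mset; apply: (mulfI (subX_neq0 (lo_neq_hi i))).
by rewrite mulrN !isobaric_bar_mul !msym_simple_X !mset_swap -mulrN opprB.
Qed.

(* The exponents that can occur in [isobaric_bar i 'X_[c]]: the value at [lo i]
   ranges over the half-open interval from the smaller to the larger of
   [c (lo i)] and [c (hi i)]. *)
Definition segment i c d : Prop := exists p q, [/\ d = mset c i p q,
  (p + q = c (lo i) + c (hi i))%N, (minn (c (lo i)) (c (hi i)) <= p)%N &
  (p < maxn (c (lo i)) (c (hi i)))%N].

Lemma isobaric_barX_support i c d :
  d \in msupp (isobaric_bar i 'X_[c]) -> segment i c d.
Proof.
rewrite mcoeff_msupp => nz.
have key q k : c = mset c i (k + q) q \/ c = mset c i q (k + q) ->
    exists2 l : 'I_k, d = mset c i (l + q) (k - l + q) & True.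
  move=> E.
  have : (\sum_(l < k) 'X_[mset c i (l + q) (k - l + q)])@_d != 0 :> int.
    case: E nz => {1}->; first by rewrite isobaric_bar_mset.
    by rewrite isobaric_bar_mset_neg mcoeffN oppr_eq0.
  rewrite raddf_sum /= => nz'.
  have [l El|E0] := pickP (fun l : 'I_k => mset c i (l + q) (k - l + q) == d).
    by exists l => //; rewrite (eqP El).
  rewrite big1 ?eqxx // in nz' => l _.
  by rewrite mcoeffX E0.
have [h|h] := leqP (c (hi i)) (c (lo i)).
  have [|l -> _] := key (c (hi i)) (c (lo i) - c (hi i))%N.
    by left; rewrite subnK // mset_id.
  exists (l + c (hi i))%N, (c (lo i) - c (hi i) - l + c (hi i))%N.
  have := ltn_ord l; split => //; lia.
have [|l -> _] := key (c (lo i)) (c (hi i) - c (lo i))%N.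
  by right; rewrite subnK ?mset_id // ltnW.
exists (l + c (lo i))%N, (c (hi i) - c (lo i) - l + c (lo i))%N.
have := ltn_ord l; split => //; lia.
Qed.

Lemma isobaric_bar_support i f d : d \in msupp (isobaric_bar i f) ->
  exists2 c, c \in msupp f & segment i c d.
Proof.
rewrite {1}[f]mpolyE.
have -> r : isobaric_bar i (\sum_(m <- r) f@_m *: 'X_[m]) =
    \sum_(m <- r) f@_m *: isobaric_bar i 'X_[m].
  elim: r => [|m r IH]; first by rewrite !big_nil isobaric_bar0.
  by rewrite !big_cons isobaric_barD isobaric_barZ IH.
rewrite mcoeff_msupp raddf_sum /= => nz.
have [/hasP[c cf nzc]|/hasPn no] :=
  boolP (has (fun c => d \in msupp (isobaric_bar i 'X_[c])) (msupp f)).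
  by exists c => //; apply: isobaric_barX_support.
rewrite big_seq big1 ?eqxx // in nz => c cf.
by rewrite mcoeffZ (memN_msupp_eq0 (no c cf)) mulr0.
Qed.

End Support.

(** * Atoms along paths of ascents, and their agreement with [demazure_atom] *)

Section Atoms.
Variable n : nat.
Implicit Types (i j : 'I_n.-1) (f g h : {mpoly int[n]}) (m c d : 'X_{1..n}).

Definition dominant m := forall i, (m (hi i) <= m (lo i))%N.

(* Demazure atoms without a choice of reduced word: the paths from [m] to its
   dominant rearrangement through ascents are the reduced words of the minimal
   sorting permutation. *)
Inductive atom : 'X_{1..n} -> {mpoly int[n]} -> Prop :=
| atom_dominant m : dominant m -> atom m 'X_[m]
| atom_ascent m i g : (m (lo i) < m (hi i))%N -> atom (mswap i m) g ->
    atom m (isobaric_bar i g).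

(** The cardinality is the Coxeter length of the minimal sorting permutation, by [word_coinv] and
    [sorting_word]; it is the induction measure for [atom]. *)
Definition coinv m : {set 'I_n * 'I_n} :=
  [set xy : 'I_n * 'I_n | (xy.1 < xy.2)%N && (m xy.1 < m xy.2)%N].

Lemma val_simple i x : simple i x = (if x == i :> nat then i.+1
  else if x == i.+1 :> nat then i : nat else x) :> nat.
Proof.
rewrite /simple; case: tpermP => [->|->|] /=; first by rewrite eqxx.
  by rewrite eqxx; case: eqP => //; lia.
by move=> /eqP xl /eqP xh; rewrite -val_eqE /= in xl xh; rewrite -val_eqE /= in xh;
  rewrite (negPf xl) (negPf xh).
Qed.

Lemma simple_mono i (x y : 'I_n) : (x < y)%N -> (x, y) != (lo i, hi i) ->
  (simple i x < simple i y)%N.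
Proof.
rewrite xpair_eqE -!val_eqE /= !val_simple.
by do ![case: eqP => ? ]; rewrite /=; lia.
Qed.

(** The swap removes the pair [(lo i, hi i)], and [simple i] matches the other coinversions
    bijectively, since it preserves the order of every other pair of positions. *)
Lemma card_coinv m i : (m (lo i) < m (hi i))%N ->
  #|coinv m| = #|coinv (mswap i m)|.+1.
Proof.
move=> asc; pose F (xy : 'I_n * 'I_n) := (simple i xy.1, simple i xy.2).
have FK : involutive F by case=> x y; rewrite /F /= !simpleK.
rewrite (cardsD1 (lo i, hi i)) inE /= ltnSn asc add1n; congr _.+1.
have memF (A : {set 'I_n * 'I_n}) z : (z \in F @: A) = (F z \in A).
  by rewrite -{1}[z]FK (mem_imset _ _ (inv_inj FK)).
rewrite -(card_imset (mem (coinv (mswap i m))) (inv_inj FK)).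
apply: eq_card => -[x y]; rewrite memF !inE /F /= !mnmE !simpleK.
have [[-> ->]|ne] /= := eqVneq.
  by rewrite /simple tpermL tpermR /= ltnNge leqnSn.
apply/andP/andP => -[xy mxy]; split => //; first exact: simple_mono.
rewrite -[x](simpleK i) -[y](simpleK i); apply: simple_mono => //.
apply: contraL mxy => /eqP[] /(congr1 (simple i)); rewrite simpleK => ->.
move=> /(congr1 (simple i)); rewrite simpleK => ->.
by rewrite /simple tpermL tpermR -leqNgt ltnW.
Qed.

Lemma dominantP m : dominant m \/ exists i, (m (lo i) < m (hi i))%N.
Proof.
have [/existsP|/existsPn no] := boolP [exists i, (m (lo i) < m (hi i))%N].
  by right.
by left => i; rewrite leqNgt.
Qed.

Lemma atom_exists m : exists f, atom m f.
Proof.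
have [k] := ubnP #|coinv m|; elim: k m => // k IH m le.
have [dom|[i asc]] := dominantP m; first by eexists; apply: atom_dominant.
have [|g Ag] := IH (mswap i m); first by move: le; rewrite (card_coinv asc).
by eexists; apply: atom_ascent asc Ag.
Qed.

Lemma mswap_comm i j m : (i.+1 < j)%N ->
  mswap i (mswap j m) = mswap j (mswap i m).
Proof.
move=> ij; apply/mnmP => x; rewrite !mnmE; congr (m _).
have cij : (simple j ^ simple i = simple j)%g.
  by rewrite {1}/simple tpermJ !simple_other // -val_eqE /=; lia.
by rewrite -!permM [in RHS]conjgC cij.
Qed.

Lemma mswap_braid i j m : (j = i.+1 :> nat) ->
  mswap i (mswap j (mswap i m)) = mswap j (mswap i (mswap j m)).
Proof.
move=> ij; apply/mnmP => x; rewrite !mnmE; congr (m _); apply: val_inj.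
rewrite /= !val_simple ij; move: (nat_of_ord x) => k.
have F1 : (i == i.+1 :> nat) = false by lia.
have F2 : (i == i.+2 :> nat) = false by lia.
have F3 : (i.+1 == i :> nat) = false by lia.
have F4 : (i.+2 == i :> nat) = false by lia.
have [E|?] := eqVneq k i; first by rewrite ?E !(eqSS, eqxx, F1, F2, F3, F4).
have [E|?] := eqVneq k i.+1; first by rewrite ?E !(eqSS, eqxx, F1, F2, F3, F4).
have [E|?] := eqVneq k i.+2; first by rewrite ?E !(eqSS, eqxx, F1, F2, F3, F4).
by rewrite !ifN.
Qed.

(** A local confluence argument: two first ascents extend to paths with a common end, and the
    commutation or braid relation equates the resulting operators. The induction hypothesis
    identifies the given atoms with those on these paths. *)
Lemma atom_unique m f g : atom m f -> atom m g -> f = g.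
Proof.
have [k] := ubnP #|coinv m|; elim: k m f g => // k IH m f g le Af Ag.
have swap i h h' : (m (lo i) < m (hi i))%N -> atom (mswap i m) h ->
  atom (mswap i m) h' -> h = h'.
  by move=> asc; apply: IH; move: le; rewrite (card_coinv asc).
case: Af le swap Ag => {}m; first move=> dom.
  move=> _ _ Ag; case: Ag dom => // {}m i h asc _ /(_ i).
  by rewrite leqNgt asc.
move=> i f' asci Af' le swap Ag; case: Ag asci Af' le swap => {}m.
  by move=> dom asc; have := dom i; rewrite leqNgt asc.
move=> j g' ascj Ag' asci Af' le swap.
have far (a b : 'I_n.-1) f1 g1 : (a.+1 < b)%N -> (m (lo a) < m (hi a))%N ->
    (m (lo b) < m (hi b))%N -> atom (mswap a m) f1 -> atom (mswap b m) g1 ->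
    isobaric_bar a f1 = isobaric_bar b g1.
  move=> ab asca ascb Af1 Ag1.
  have d1 : lo b != lo a by rewrite -val_eqE /=; lia.
  have d2 : lo b != hi a by rewrite -val_eqE /=; lia.
  have d3 : hi b != lo a by rewrite -val_eqE /=; lia.
  have d4 : hi b != hi a by rewrite -val_eqE /=; lia.
  have [h Ah] := atom_exists (mswap b (mswap a m)).
  have -> : f1 = isobaric_bar b h.
    apply: swap asca Af1 _; apply: atom_ascent => //.
    by rewrite !mswap_other.
  have -> : g1 = isobaric_bar a h.
    apply: swap ascb Ag1 _; apply: atom_ascent; last by rewrite mswap_comm.
    by rewrite !mswap_other // eq_sym.
  exact: isobaric_bar_comm.
have near (a b : 'I_n.-1) f1 g1 : (b = a.+1 :> nat)%N -> (m (lo a) < m (hi a))%N ->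
    (m (lo b) < m (hi b))%N -> atom (mswap a m) f1 -> atom (mswap b m) g1 ->
    isobaric_bar a f1 = isobaric_bar b g1.
  move=> ab asca ascb Af1 Ag1.
  have ehi : lo b = hi a by apply: val_inj; rewrite /= ab.
  have d1 : hi b != lo a by rewrite -val_eqE /= ab; lia.
  have d2 : hi b != hi a by rewrite -val_eqE /= ab; lia.
  have d3 : lo a != lo b by rewrite -val_eqE /= ab; lia.
  have d4 : lo a != hi b by rewrite eq_sym.
  (* The three consecutive entries strictly increase, so both ways of reversing them go through
     ascents only; [ascc] is the middle ascent of each. *)
  have ascc : (m (lo a) < m (hi b))%N by apply: ltn_trans asca _; rewrite -ehi.
  have [h Ah] := atom_exists (mswap a (mswap b (mswap a m))).
  have -> : f1 = isobaric_bar b (isobaric_bar a h).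
    apply: swap asca Af1 _; apply: atom_ascent.
      by rewrite ehi mswap_hi mswap_other.
    apply: atom_ascent => //.
    by rewrite (mswap_other _ d3 d4) mswap_lo -ehi mswap_lo mswap_other.
  have -> : g1 = isobaric_bar a (isobaric_bar b h).
    apply: swap ascb Ag1 _; apply: atom_ascent.
      by rewrite mswap_other // -ehi mswap_lo.
    apply: atom_ascent; last by rewrite -mswap_braid.
    by rewrite (mswap_other _ d1 d2) mswap_hi ehi mswap_hi mswap_other // -ehi.
  exact: isobaric_bar_braid.
have [ij|ji|/val_inj ij] := ltngtP i j.
- have [E|ne] := eqVneq (j : nat) i.+1; first exact: near.
  by apply: far => //; lia.
- apply: esym; have [E|ne] := eqVneq (i : nat) j.+1; first exact: near.
  by apply: far => //; lia.
- by move: Ag'; rewrite -ij => Ag'; congr isobaric_bar; apply: swap Ag'.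
Qed.

Lemma atom_step m f i : atom m f -> (m (lo i) < m (hi i))%N ->
  exists2 g, atom (mswap i m) g & f = isobaric_bar i g.
Proof.
move=> Af asc; have [g Ag] := atom_exists (mswap i m); exists g => //.
exact: atom_unique Af (atom_ascent asc Ag).
Qed.

Lemma card_coinv_swap m i : (#|coinv m| <= #|coinv (mswap i m)|.+1)%N.
Proof.
have [asc|desc|eq] := ltngtP (m (lo i)) (m (hi i)).
- by rewrite (card_coinv asc).
- have := @card_coinv (mswap i m) i; rewrite mswapK mswap_lo mswap_hi => ->//.
  by rewrite !leqW.
- by rewrite mswap_id.
Qed.

Lemma coinv_dominant m : dominant m -> #|coinv m| = 0%N.
Proof.
move=> dom; apply: eq_card0 => -[x y]; rewrite !inE /=.
apply/negP => /andP[xy]; apply/negP; rewrite -leqNgt; move: xy.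
have [k] := ubnP (y - x)%N; elim: k y => // k IH y le xy.
have yn : (y.-1 < n.-1)%N by have := ltn_ord y; lia.
have E : y = hi (Ordinal yn) by apply: val_inj => /=; lia.
rewrite E; apply: leq_trans (dom _) _.
have [E'|ne] := eqVneq (lo (Ordinal yn)) x; first by rewrite E'.
apply: IH; move: ne; rewrite -val_eqE /=; lia.
Qed.

(** Each letter lowers the number of coinversions by at most one, and a dominant exponent has
    none. *)
Lemma word_coinv m d (s : seq 'I_n.-1) : dominant d ->
  (forall x, d (word_perm s x) = m x) -> (#|coinv m| <= size s)%N.
Proof.
move=> dom; elim: s m => [|i s IH] m E.
  have -> : m = d by apply/mnmP => x; rewrite -E /word_perm big_nil perm1.
  by rewrite coinv_dominant.
apply: leq_trans (card_coinv_swap m i) _; rewrite ltnS; apply: IH => x.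
by rewrite mnmE -E /word_perm big_cons permM simpleK.
Qed.

(** A sorting word this short must lose one coinversion at every letter, so each letter is an ascent
    and the word is a path for [atom]. *)
Lemma word_atom m d (s : seq 'I_n.-1) : dominant d ->
  (forall x, d (word_perm s x) = m x) -> (size s <= #|coinv m|)%N ->
  atom m (foldr (@isobaric_bar n) 'X_[d] s).
Proof.
move=> dom; elim: s m => [|i s IH] m E le.
  have -> : m = d by apply/mnmP => x; rewrite -E /word_perm big_nil perm1.
  exact: atom_dominant.
have E' x : d (word_perm s x) = mswap i m x.
  by rewrite mnmE -E /word_perm big_cons permM simpleK.
have le' := word_coinv dom E'.
have asc : (m (lo i) < m (hi i))%N.
  rewrite ltnNge; apply/negP => desc.
  suff h : (#|coinv m| <= #|coinv (mswap i m)|)%N.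
    by have := leq_trans le (leq_trans h le'); rewrite ltnn.
  move: desc; rewrite leq_eqVlt => /orP[/eqP eq|desc]; first by rewrite mswap_id.
  by rewrite (@card_coinv (mswap i m) i) ?mswapK // mswap_lo mswap_hi.
apply: atom_ascent => //; apply: IH => //.
by move: le; rewrite (card_coinv asc).
Qed.

Lemma sorting_word m : exists (s : seq 'I_n.-1) d, [/\ dominant d,
  forall x, d (word_perm s x) = m x & size s = #|coinv m|].
Proof.
have [k] := ubnP #|coinv m|; elim: k m => // k IH m le.
have [dom|[i asc]] := dominantP m.
  exists [::], m; split => //; last by rewrite coinv_dominant.
  by move=> x; rewrite /word_perm big_nil perm1.
have [|s [d [dom E sz]]] := IH (mswap i m); first by move: le; rewrite (card_coinv asc).
exists (i :: s), d; split => //; last by rewrite /= sz (card_coinv asc).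
by move=> x; rewrite /word_perm big_cons permM E mnmE simpleK.
Qed.

Lemma sort_comp_dominant (a : n.-tuple nat) : dominant (Multinom (sort_comp a)).
Proof.
move=> i; rewrite !multinomE !(tnth_nth 0%N) /=.
have /(sortedP 0%N) srt : sorted geq (sort geq a).
  by apply: sort_sorted => x y; apply: leq_total.
by apply: srt; rewrite size_sort size_tuple; apply: (ltn_ord (hi i)).
Qed.

Lemma dominant_tuple_sorted m : dominant m -> sorted geq (m : n.-tuple nat).
Proof.
move=> dom; apply/(sortedP 0%N) => k; rewrite size_tuple => kn.
have kn' : (k < n.-1)%N by lia.
have := dom (Ordinal kn'); by rewrite !mnm_tnth !(tnth_nth 0%N) /=.
Qed.

(** The word from [sorting_word] competes in the minimality of [sorting_perm], so the chosen reduced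
    word has at most [#|coinv|] letters and [word_atom] applies. *)
Lemma demazure_atomP (a : n.-tuple nat) : atom (Multinom a) (demazure_atom a).
Proof.
rewrite /demazure_atom /isobaric_bar_perm.
set w := sorting_perm a.
have /andP[Hw /forallP minw] : sends_to_sort a w &&
    [forall v : 'S_n, sends_to_sort a v ==> (perm_length w <= perm_length v)%N].
  exact: xchooseP (sorting_perm_ex a).
have /andP[/eqP Ew /eqP sz] : (word_perm (reduced_word w) == w) &&
    (size (reduced_word w) == perm_length w).
  exact: xchooseP (reduced_word_ex w).
apply: word_atom; first exact: sort_comp_dominant.
  by move=> x; rewrite Ew !multinomE; apply/eqP/(forallP Hw).
rewrite sz; have [s [d [dom E <-]]] := sorting_word (Multinom a).
have Ed : (d : n.-tuple nat) = sort_comp a.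
  apply: val_inj => /=; apply: (@sorted_eq _ geq) => //.
  - by move=> x y z yx zx; apply: leq_trans zx yx.
  - by move=> x y xy; apply/eqP; rewrite eqn_leq andbC.
  - exact: dominant_tuple_sorted.
  - by apply: sort_sorted => x y; apply: leq_total.
  rewrite perm_sym perm_sort; apply/tuple_permP; exists (word_perm s).
  congr tval; apply: eq_from_tnth => x.
  by rewrite tnth_mktuple -mnm_tnth E multinomE.
have sv : sends_to_sort a (word_perm s).
  by apply/forallP => x; rewrite -Ed -mnm_tnth E multinomE.
apply: leq_trans (implyP (minw _) sv) _.
rewrite /perm_length; case: ex_minnP => k _; apply.
by apply/existsP; exists (in_tuple s).
Qed.
End Atoms.

(** * Norm, degree and prefix-sum bounds on the support of an atom *)

Lemma sqr_segment (a b p q : nat) : (p + q = a + b -> minn a b <= p ->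
  p < maxn a b -> p * p + q * q <= a * a + b * b
    /\ (p != minn a b -> p * p + q * q < a * a + b * b))%N.
Proof.
wlog le : a b / (a <= b)%N => [H|].
  case/orP: (leq_total a b) => [/H//|ba].
  by rewrite minnC maxnC [(a + _)%N]addnC [(a * a + _)%N]addnC; apply: H.
rewrite (minn_idPl le) (maxn_idPr le) => e ap pb.
(* With [p = a + s], [q = a + t] and [b = a + s + t], the two sums of squares differ by [2 * s * t];
   as [t > 0], equality forces [s = 0]. *)
have [s Es] : exists s, p = (a + s)%N by exists (p - a)%N; lia.
have [t Et] : exists t, b = (p + t)%N by exists (b - p)%N; lia.
have Eq : q = (a + t)%N by lia.
by split=> [|pa]; subst; nia.
Qed.

Section Invariants.
Variable n : nat.
Implicit Types (i j : 'I_n.-1) (f g h : {mpoly int[n]}) (m c d : 'X_{1..n}).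

Lemma sum_lo_hi i (F : 'I_n -> nat) : (\sum_x F x = F (lo i) + (F (hi i) +
  \sum_(x | (x != lo i) && (x != hi i)) F x))%N.
Proof. exact: big_lo_hi. Qed.

Definition sqnorm m := (\sum_x m x * m x)%N.

Lemma sqnorm_mswap i m : sqnorm (mswap i m) = sqnorm m.
Proof.
rewrite /sqnorm !(sum_lo_hi i) mswap_lo mswap_hi addnCA; congr (_ + (_ + _))%N.
by apply: eq_bigr => x /andP[xl xh]; rewrite mswap_other.
Qed.

Lemma sqnorm_mset i c p q : (sqnorm (mset c i p q) = p * p + (q * q +
  \sum_(x | (x != lo i) && (x != hi i)) c x * c x))%N.
Proof.
rewrite /sqnorm (sum_lo_hi i) mset_lo mset_hi; congr (_ + (_ + _))%N.
by apply: eq_bigr => x /andP[xl xh]; rewrite mset_other.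
Qed.

Lemma sqnorm_segment i c d : segment i c d -> (sqnorm d <= sqnorm c)%N.
Proof.
case=> p [q [-> e lep ltp]]; rewrite -{2}(mset_id c i) !sqnorm_mset !addnA leq_add2r.
by case: (sqr_segment e lep ltp).
Qed.

Lemma sqnorm_segment_ascent i m d : (m (lo i) < m (hi i))%N ->
  segment i (mswap i m) d -> d != m -> (sqnorm d < sqnorm m)%N.
Proof.
move=> asc [p [q []]]; rewrite mswap_lo mswap_hi => -> e lep ltp ne.
rewrite -{2}(mswapK i m) sqnorm_mswap -{2}(mset_id (mswap i m) i) !sqnorm_mset.
rewrite !addnA ltn_add2r mswap_lo mswap_hi.
case: (sqr_segment e lep ltp) => _; apply.
apply: contra ne => /eqP Ep.
have -> : p = m (lo i) by lia.
have -> : q = m (hi i) by lia.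
by rewrite mset_mswap.
Qed.

Lemma atom_support_sqnorm m f : atom m f ->
  forall c, c \in msupp f -> c != m -> (sqnorm c < sqnorm m)%N.
Proof.
elim=> {m f} [m dom c|m i g asc _ IH c /isobaric_bar_support[c' c'g seg] ne].
  by rewrite msuppX inE => /eqP->; rewrite eqxx.
have [E|ne'] := eqVneq c' (mswap i m).
  by apply: (sqnorm_segment_ascent asc) ne; rewrite -E.
apply: leq_ltn_trans (sqnorm_segment seg) _.
by rewrite -(sqnorm_mswap i m); apply: IH.
Qed.

Lemma atom_lead_coef m f : atom m f -> f@_m = 1.
Proof.
elim=> {m f} [m dom|m i g asc Ag IH]; first by rewrite mcoeffX eqxx.
(* Split off the leading monomial of [g]: the other exponents have smaller norm than [m], and an
   operator does not raise the norm, so they cannot produce [m]. *)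
rewrite -[g](subrK 'X_[mswap i m]) isobaric_barD mcoeffD.
rewrite [X in X + _ = _]memN_msupp_eq0 ?add0r; last first.
  apply/negP => /isobaric_bar_support[c cs seg].
  have ne : c != mswap i m.
    apply: contraTneq cs => ->.
    by rewrite mcoeff_msupp mcoeffB IH mcoeffX eqxx subrr eqxx.
  have cg : c \in msupp g.
    by move: cs; rewrite !mcoeff_msupp mcoeffB mcoeffX [_ == c]eq_sym (negPf ne) subr0.
  have := atom_support_sqnorm Ag cg ne; rewrite sqnorm_mswap.
  by rewrite ltnNge (sqnorm_segment seg).
have Em : mset m i (m (hi i)) (m (lo i)) = mswap i m.
  by rewrite -mset_swap mset_id.
have [k Ek] : exists k, m (hi i) = (k.+1 + m (lo i))%N.
  by exists (m (hi i) - m (lo i)).-1; lia.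
(* The term [l = 0] is the monomial of [m]; the others have a larger exponent at [lo i]. *)
rewrite -Em Ek isobaric_bar_mset big_ord_recl mcoeffD add0n subn0 -Ek mset_id.
rewrite mcoeffX eqxx raddf_sum /= big1 ?addr0 // => l _.
rewrite mcoeffX; case: eqP => // /mnmP /(_ (lo i)); rewrite mset_lo.
by rewrite /bump /=; lia.
Qed.

Lemma atom_mdeg m f : atom m f -> forall c, c \in msupp f -> mdeg c = mdeg m.
Proof.
elim=> {m f} [m dom c|m i g asc _ IH c /isobaric_bar_support[c' c'g seg]].
  by rewrite msuppX inE => /eqP->.
have -> : mdeg m = mdeg (mswap i m) by rewrite mdeg_mperm.
rewrite -(IH _ c'g) !mdegE; case: seg => p [q [-> e _ _]].
rewrite !(sum_lo_hi i) mset_lo mset_hi !addnA e; congr (_ + _)%N.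
by apply: eq_bigr => x /andP[xl xh]; rewrite mset_other.
Qed.

Definition above k t m := (\sum_(x < n) (x < k) && (t < m x))%N.

Lemma above_mswap i k t m : k != i.+1 -> above k t (mswap i m) = above k t m.
Proof.
move=> ki; rewrite /above !(sum_lo_hi i) mswap_lo mswap_hi /=.
have -> : (i.+1 < k)%N = (i < k)%N by lia.
rewrite addnCA; congr (_ + (_ + _))%N.
by apply: eq_bigr => x /andP[xl xh]; rewrite mswap_other.
Qed.

Lemma above_rest i k t m : (i <= k <= i.+2)%N ->
  above k t m = ((i < k) && (t < m (lo i)) + ((i.+1 < k) && (t < m (hi i)) + above i t m))%N.
Proof.
move=> kk; have E : (i.+1 < i)%N = false by lia.
rewrite /above !(sum_lo_hi i) /= ltnn E !add0n.
congr (_ + (_ + _))%N; apply: eq_bigr => x /andP[].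
rewrite -!val_eqE /= => xl xh; congr (nat_of_bool (_ && _)); lia.
Qed.

Definition weight (w : 'I_n -> nat) m := (\sum_x w x * m x)%N.

(* The tableau criterion for the Bruhat order, one threshold [t] at a time. *)
Definition bruhat_ge m b := forall k t, (above k t m <= above k t b)%N.

(** The lifting property of the Bruhat order. Only prefixes of length [i.+1] see a swap at [i]; for
    [mswap i b] the bound there is deduced from those at [i], [i.+1] and [i.+2]. *)
Lemma bruhat_ge_ascent i m b : (m (lo i) < m (hi i))%N ->
  bruhat_ge (mswap i m) b -> bruhat_ge m b /\ bruhat_ge m (mswap i b).
Proof.
have le1 : (i <= i.+1 <= i.+2)%N by lia.
have le2 : (i <= i.+2 <= i.+2)%N by lia.
move=> asc B; split=> k t; have := B k t.
  have [->|ki] := eqVneq k i.+1; last by rewrite above_mswap.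
  rewrite !(above_rest _ _ le1) mswap_lo mswap_hi ltnSn ltnn /= !add0n.
  rewrite (@above_mswap i i) ?ltn_eqF // => /(leq_trans _); apply.
  by rewrite leq_add2r; case: leqP => //; move/ltn_trans => /(_ _ asc) ->.
have [->|ki] := eqVneq k i.+1; last by rewrite !above_mswap.
have := B i t; have := B i.+2 t.
rewrite !(above_rest _ _ le1) !(above_rest _ _ le2).
rewrite !(@above_mswap i i) ?ltn_eqF // !mswap_lo !mswap_hi ltnSn ltnn leqnSn /= !add0n.
have : (t < m (lo i) -> t < m (hi i))%N by move=> h; apply: ltn_trans asc.
by case: (t < m (lo i))%N => [->//|_]; case: (t < m (hi i))%N;
  case: (t < b (lo i))%N; case: (t < b (hi i))%N => /=; lia.
Qed.

(** A linear functional on a segment is minimal at one of the ends, here [c] and [mswap i c]. *)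
Lemma weight_segment i w c d : segment i c d ->
  (minn (weight w c) (weight w (mswap i c)) <= weight w d)%N.
Proof.
case=> p [q [-> e lep ltp]]; rewrite /weight !(sum_lo_hi i).
rewrite mswap_lo mswap_hi mset_lo mset_hi.
rewrite [X in (_ <= _ + (_ + X))%N](eq_bigr (fun x => w x * c x)%N); last first.
  by move=> x /andP[xl xh]; rewrite mset_other.
rewrite [X in minn _ (_ + (_ + X))](eq_bigr (fun x => w x * c x)%N); last first.
  by move=> x /andP[xl xh]; rewrite mswap_other.
move: (\sum_(_ | _) _)%N (w (lo i)) (w (hi i)) (c (lo i)) (c (hi i)) e lep ltp.
move=> R u v a b e lep ltp; rewrite !addnA -addn_minl leq_add2r geq_min.
apply/orP.
wlog ab : a b e lep ltp / (a <= b)%N.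
  move=> H; case/orP: (leq_total a b) => [|ba]; first exact: H.
  by rewrite or_comm; apply: H => //; rewrite 1?minnC 1?maxnC 1?[RHS]addnC.
have [s Es] : exists s, p = (a + s)%N by exists (p - a)%N; lia.
have [t Et] : exists t, b = (p + t)%N by exists (b - p)%N; lia.
have Eq : q = (a + t)%N by lia.
by subst; have [uv|vu] := leqP u v; [right | left]; nia.
Qed.

Lemma weight_mswap i w c : weight w (mswap i c) = weight (w \o simple i) c.
Proof.
rewrite /weight (reindex_inj (@perm_inj _ (simple i))) /=.
by apply: eq_bigr => x _; rewrite mnmE simpleK.
Qed.

(* Dual form, by nonnegative linear functionals, of the fact that the exponents of
   the atom of [m] lie in the convex hull of exponents Bruhat-above [m]. *)
Lemma atom_support_weight m f : atom m f -> forall c, c \in msupp f ->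
  forall w, exists2 b, bruhat_ge m b & (weight w b <= weight w c)%N.
Proof.
elim=> {m f} [m dom c cf|m i g asc _ IH c /isobaric_bar_support[c' c'g seg]] w.
  by move: cf; rewrite msuppX inE => /eqP->; exists m.
have := weight_segment w seg; rewrite geq_min => /orP[|] le.
  have [b B leb] := IH _ c'g w; exists b; last exact: leq_trans le.
  by case: (bruhat_ge_ascent asc B).
have [b B leb] := IH _ c'g (w \o simple i); exists (mswap i b).
  by case: (bruhat_ge_ascent asc B).
by rewrite weight_mswap (leq_trans leb) // -weight_mswap.
Qed.

Lemma le_mdeg m x : (m x <= mdeg m)%N.
Proof. by rewrite mdegE (bigD1 x) //= leq_addr. Qed.

Definition prefix_sum k m := (\sum_(x < n | x < k) m x)%N.

(** Each entry is the number of thresholds [t] below it; exchange the two summations. *)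
Lemma prefix_sum_above k m N : (forall x, m x <= N)%N ->
  prefix_sum k m = (\sum_(t < N) above k t m)%N.
Proof.
move=> le; rewrite /prefix_sum /above exchange_big big_mkcond /=; apply: eq_bigr => x _.
have E : m x = (\sum_(t < N) (t < m x))%N.
  rewrite -[LHS]card_ord -sum1_card (big_ord_widen N (fun=> 1%N) (le x)) big_mkcond.
  by apply: eq_bigr => t _; case: ltnP.
by case: ltnP => _ /=; [exact: E | rewrite big1].
Qed.

(** The indicator of the first [k] positions serves as the functional, and the Bruhat inequalities
    are summed over all thresholds. *)
Lemma atom_support_prefix m f : atom m f -> forall c, c \in msupp f ->
  forall k, (prefix_sum k m <= prefix_sum k c)%N.
Proof.
move=> Af c cf k.
have [b B] := atom_support_weight Af cf (fun x : 'I_n => (x < k)%N).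
have W d : weight (fun x : 'I_n => (x < k)%N) d = prefix_sum k d.
  rewrite /weight /prefix_sum [RHS]big_mkcond; apply: eq_bigr => x _.
  by case: ltnP; rewrite ?mul1n.
rewrite !W; apply: leq_trans.
pose N := maxn (mdeg m) (mdeg b).
rewrite !(@prefix_sum_above k _ N); first exact: leq_sum.
  by move=> x; rewrite leq_max le_mdeg orbT.
by move=> x; rewrite leq_max le_mdeg.
Qed.

End Invariants.

(** * Which atoms are single monomials *)

Section Monomial.
Variable n : nat.
Implicit Types (i j : 'I_n.-1) (f g h : {mpoly int[n]}) (m c d : 'X_{1..n}).

Definition slow_growth m := forall i, (m (hi i) <= (m (lo i)).+1)%N.

(** The step into [x] is free; instead the two neighbours of [x] satisfy the bound with each other.
    This survives moving the entry at [x] left past a smaller one. *)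
Definition slow_growth_but (x : 'I_n) m :=
  (forall i, hi i != x -> m (hi i) <= (m (lo i)).+1)%N /\
  (forall i j, hi i = x -> lo j = x -> m (hi j) <= (m (lo i)).+1)%N.

(* Invariant while a large entry, now at position [x], travels to the right; the
   word beyond [x] is untouched by the operators applied so far. *)
Definition near_monomial (x : 'I_n) m c :=
  [/\ forall y : 'I_n, (x < y)%N -> c y = m y, (c x <= m x)%N,
      c x = m x -> c = m &
      forall i, hi i = x -> (minn (m x) (m (lo i)).+1 <= c x)%N].

Lemma slow_growth_but_swap i m : (m (lo i) < m (hi i))%N ->
  slow_growth_but (hi i) m -> slow_growth_but (lo i) (mswap i m).
Proof.
move=> asc [S1 S2]; split=> [a|a b] ha.
  have [->|ai] := eqVneq a i; first by rewrite mswap_lo mswap_hi leqW // ltnW.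
  have nhh : hi a != hi i by apply: contra ai; rewrite -!val_eqE.
  have nll : lo a != lo i by apply: contra ai; rewrite -!val_eqE.
  have [lh|nlh] := eqVneq (lo a) (hi i).
    by rewrite lh mswap_hi mswap_other //; apply: S2.
  by rewrite !mswap_other //; apply: S1.
move=> lb; have -> : b = i by apply: val_inj; have := congr1 val lb.
have val_ha : a.+1 = i by have := congr1 val ha.
rewrite mswap_hi mswap_other -?val_eqE /=; try lia.
by rewrite -ha; apply: S1; rewrite -val_eqE /=; lia.
Qed.

(** The new entry at [hi i] lies strictly above [m (lo i)] and is at most [c (lo i)], hence at most
    [m (hi i)]. Equality with [m (hi i)] forces [c = mswap i m] and then [d = m]. *)
Lemma near_monomial_step i m c d : (m (lo i) < m (hi i))%N ->
  near_monomial (lo i) (mswap i m) c -> (m (lo i) <= c (lo i))%N ->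
  segment i c d -> near_monomial (hi i) m d.
Proof.
move=> asc [C1 C2 C3 _] le [p [q [-> e lep ltp]]].
have chi : c (hi i) = m (lo i) by rewrite C1 ?mswap_hi //=.
rewrite mswap_lo in C2 C3; rewrite chi in e lep ltp.
rewrite (minn_idPr le) in lep; rewrite (maxn_idPl le) in ltp.
split; rewrite ?mset_hi.
- move=> y hy; have ny : (y != lo i) && (y != hi i) by rewrite -!val_eqE /= in hy *; lia.
  case/andP: ny => yl yh; rewrite mset_other // C1 ?mswap_other //.
  by rewrite /= in hy *; lia.
- lia.
- move=> qe; have E : c (lo i) = m (hi i) by lia.
  have -> : p = m (lo i) by lia.
  by rewrite (C3 E) qe mset_mswap.
- move=> a ha; have -> : a = i by apply: val_inj; have := congr1 val ha; case.
  by rewrite geq_min; apply/orP; right; lia.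
Qed.

(** At an ascent the lower bound in [near_monomial] equals [m (hi i)] under slow growth, so [c = m].
    The near-monomial claim is a hypothesis because this lemma also serves inside the induction
    proving that claim. *)
Lemma near_monomial_slow_growth m f : atom m f ->
  (forall i, slow_growth_but (hi i) m -> (m (lo i) < m (hi i))%N ->
     forall c, c \in msupp f -> near_monomial (hi i) m c) ->
  slow_growth m -> forall c, c \in msupp f -> c = m.
Proof.
move=> Af N sg c cf; have [dom|[i0 asc0]] := dominantP m.
  rewrite (atom_unique Af (atom_dominant dom)) msuppX inE in cf.
  exact/eqP.
(* Past the last ascent entries do not increase, so the entry after [hi i] is at most [m (hi i)],
   which gives the neighbour condition. *)
case: (@arg_maxnP _ i0 (fun i => m (lo i) < m (hi i))%N (@nat_of_ord _) asc0) => i asc last.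
have Si : slow_growth_but (hi i) m.
  split=> [a _|a b ha lb]; first exact: sg.
  have Ea : a = i by apply: val_inj; have := congr1 val ha; case.
  have : (m (hi b) <= m (lo b))%N.
    rewrite leqNgt; apply/negP => /last /=; have := congr1 val lb => /= -> .
    by rewrite ltnn.
  by move/leq_trans; apply; rewrite lb Ea; apply: sg.
case: (N i Si asc c cf) => _ cle ceq /(_ i erefl) cge.
by apply: ceq; move: (sg i) cge cle; lia.
Qed.

Lemma support_slow_growth_but x m f : atom m f -> slow_growth_but x m ->
  forall c, c \in msupp f -> near_monomial x m c.
Proof.
have [k] := ubnP #|coinv m|; elim: k m f x => // k IH m f x le Af S.
have ascent i : slow_growth_but (hi i) m -> (m (lo i) < m (hi i))%N ->
    forall c, c \in msupp f -> near_monomial (hi i) m c.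
  move=> S' asc c.
  have [g Ag ->] := atom_step Af asc; move=> /isobaric_bar_support[d dg seg].
  have N : near_monomial (lo i) (mswap i m) d.
    apply: IH Ag (slow_growth_but_swap asc S') _ dg.
    by move: le; rewrite (card_coinv asc).
  apply: (near_monomial_step asc N) seg.
  (* It remains to bound [d (lo i)] below. At the left end there is no left neighbour to do so, but
     there [mswap i m] has slow growth and [d] equals it; otherwise the last clause of [N] gives the
     bound. *)
  have [i0|i0] := posnP i.
    have sg : slow_growth (mswap i m).
      have [S1 _] := slow_growth_but_swap asc S'.
      by move=> a; apply: S1; rewrite -val_eqE /= i0.
    have -> : d = mswap i m.
      apply: (near_monomial_slow_growth Ag _ sg dg) => a Sa _ c' c'g.
      by apply: IH Ag Sa _ c'g; move: le; rewrite (card_coinv asc).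
    by rewrite mswap_lo; apply: ltnW.
  have ltj : (i.-1 < n.-1)%N by apply: leq_ltn_trans (leq_pred i) (ltn_ord i).
  have E : hi (Ordinal ltj) = lo i by apply: val_inj; rewrite /= prednK.
  case: N => _ _ _ /(_ _ E); apply: leq_trans.
  rewrite mswap_lo mswap_other -?val_eqE /=; try lia.
  rewrite leq_min (ltnW asc) -E; case: S' => S1 _; apply: S1.
  by rewrite -val_eqE /=; lia.
have slow : slow_growth m -> forall c, c \in msupp f -> c = m.
  by move=> sg; apply: near_monomial_slow_growth sg.
have [/existsP[i /andP[/eqP hx asc]]|/existsPn no] :=
    boolP [exists i, (hi i == x) && (m (lo i) < m (hi i))%N].
  by move=> c cf; rewrite -hx; apply: ascent asc _ cf; rewrite hx.
move=> c cf; have -> : c = m.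
  apply: slow cf => i; have := no i; case: eqP => [hx|/eqP hx _] /=.
    by rewrite -leqNgt => /leqW.
  by case: S => S1 _; apply: S1.
by split=> // i _; rewrite geq_minl.
Qed.

Lemma support_singleton m f : atom m f -> (forall c, c \in msupp f -> c = m) ->
  f = 'X_[m].
Proof.
move=> Af sing; apply/mpolyP => c; rewrite mcoeffX.
have [<-|ne] := eqVneq; first exact: atom_lead_coef.
by apply: memN_msupp_eq0; apply: contra ne => /sing->.
Qed.

Lemma slow_growth_atom m f : atom m f -> slow_growth m -> f = 'X_[m].
Proof.
move=> Af sg; apply: (support_singleton Af).
apply: (near_monomial_slow_growth Af _ sg) => i Si _.
exact: support_slow_growth_but Af Si.
Qed.

Lemma monomial_atom_slow_growth m : atom m 'X_[m] -> slow_growth m.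
Proof.
move=> Am i; have [asc|] := ltnP (m (lo i)) (m (hi i)); last exact: leqW.
have [g _ E] := atom_step Am asc; rewrite isobaric_barE in E.
have E' := congr1 (msym (simple i)) E.
rewrite msym_simple_X msymM msym_divdiff msym_var /simple tpermR in E'.
(* Both sides are x_i x_{i+1} times the symmetric factor; comparing exponents of x_i gives
   [m (hi i) = (m (lo i)).+1]. *)
have : 'X_[U_(lo i) + m] = 'X_[U_(hi i) + mswap i m] :> {mpoly int[n]}.
  by rewrite !mpolyXD E E' mulrCA.
move/(congr1 (mcoeff (U_(lo i) + m)%MM)); rewrite !mcoeffX eqxx.
case: eqP => // /mnmP /(_ (lo i)); rewrite !mnmDE !mnm1E mswap_lo eqxx.
by rewrite [hi i == _]eq_sym (negPf (lo_neq_hi i)) => /=; lia.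
Qed.

End Monomial.

(** * Reversal of variables and comparison of the two kinds of atoms *)

Section Reversal.
Variable n : nat.
Implicit Types (i j : 'I_n.-1) (f : {mpoly int[n]}) (m c : 'X_{1..n}).

Definition mrev m : 'X_{1..n} := [multinom m (rev_ord x) | x < n].

Lemma mrevK : involutive mrev.
Proof. by move=> m; apply/mnmP => x; rewrite !mnmE rev_ordK. Qed.

Lemma mcoeff_reverse_vars f c : (reverse_vars f)@_c = f@_(mrev c).
Proof.
pose s : 'S_n := perm (@rev_ord_inj n).
have -> : reverse_vars f = msym s f.
  rewrite /reverse_vars comp_mpolyE /msym /mmap.
  apply: eq_bigr => m _; rewrite mul_mpolyC; congr (_ *: _).
  by apply: eq_bigr => x _; rewrite tnth_mktuple permE.
rewrite mcoeff_sym; congr (_ @_ _).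
by apply/mnmP => x; rewrite !mnmE permE.
Qed.

Lemma mrev_Multinom (a : n.-tuple nat) :
  mrev (Multinom a) = Multinom (rev_comp a).
Proof.
apply/mnmP => x; rewrite mnmE !multinomE !(tnth_nth 0%N) /= nth_rev size_tuple //.
Qed.

Lemma sqnorm_mrev m : sqnorm (mrev m) = sqnorm m.
Proof.
rewrite /sqnorm [RHS](reindex_inj rev_ord_inj) /=.
by apply: eq_bigr => x _; rewrite mnmE.
Qed.

Lemma prefix_sum_mrev k m : (k <= n)%N ->
  (prefix_sum k m + prefix_sum (n - k) (mrev m))%N = mdeg m.
Proof.
move=> kn; rewrite mdegE (bigID (fun x : 'I_n => x < k)%N) /=; congr (_ + _)%N.
rewrite /prefix_sum (reindex_inj rev_ord_inj) /=; apply: eq_big => x.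
  by have := ltn_ord x; lia.
by rewrite mnmE rev_ordK.
Qed.

Lemma prefix_sum_inj m c : (forall k, (k <= n)%N -> prefix_sum k m = prefix_sum k c) -> m = c.
Proof.
have S d (x : 'I_n) : prefix_sum x.+1 d = (d x + prefix_sum x d)%N.
  rewrite /prefix_sum (bigD1 x) //=; congr (_ + _)%N; apply: eq_bigl => y.
  by rewrite -val_eqE /=; lia.
move=> E; apply/mnmP => x; apply: (@addIn (prefix_sum x m)).
by rewrite {2}E -?S ?E // ltnW.
Qed.

Lemma mdeg_mrev m : mdeg (mrev m) = mdeg m.
Proof.
rewrite !mdegE [RHS](reindex_inj rev_ord_inj) /=.
by apply: eq_bigr => x _; rewrite mnmE.
Qed.

Lemma lo_rev_ord i : lo (rev_ord i) = rev_ord (hi i).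
Proof. by apply: val_inj => /=; have := ltn_ord i; lia. Qed.

Lemma hi_rev_ord i : hi (rev_ord i) = rev_ord (lo i).
Proof. by apply: val_inj => /=; have := ltn_ord i; lia. Qed.

Definition slow_variation m := slow_growth m /\ slow_growth (mrev m).

Lemma slow_variationP (a : n.-tuple nat) : slow_variation (Multinom a) <->
  forall i, `| (tnth a (lo i))%:Z - (tnth a (hi i))%:Z | <= 1.
Proof.
split=> [[up dn] i|H].
  have := up i; have := dn (rev_ord i).
  by rewrite !mnmE lo_rev_ord hi_rev_ord !rev_ordK !multinomE; lia.
split=> i; first by have := H i; rewrite !multinomE; lia.
by have := H (rev_ord i); rewrite !mnmE lo_rev_ord hi_rev_ord !multinomE; lia.
Qed.

Lemma common_atom (m m' : 'X_{1..n}) p f : atom m p -> atom (mrev m') f ->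
  (forall c, p@_c = f@_(mrev c)) -> m = m' /\ p = 'X_[m].
Proof.
move=> Ap Af E.
have suppE c : (c \in msupp p) = (mrev c \in msupp f) by rewrite !mcoeff_msupp E.
have mp : m \in msupp p by rewrite mcoeff_msupp atom_lead_coef.
have mf : mrev m' \in msupp f by rewrite mcoeff_msupp atom_lead_coef.
have mm' : m = m'.
  apply/eqP; apply: contraT => ne.
  have := atom_support_sqnorm Ap (etrans (suppE m') mf); rewrite eq_sym => /(_ ne) lt.
  rewrite suppE in mp; have := atom_support_sqnorm Af mp.
  rewrite (inj_eq (inv_inj mrevK)) !sqnorm_mrev => /(_ ne).
  by rewrite ltnNge ltnW.
split=> //; apply: (support_singleton Ap) => c cp; apply: prefix_sum_inj => k kn.
have := atom_support_prefix Ap cp k; rewrite suppE in cp.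
(* Prefix sums of the reversed exponents are suffix sums of [c] and [m]; since the degrees agree,
   this bounds the prefix sums of [c] from above. *)
have := atom_support_prefix Af cp (n - k)%N; rewrite -mm'.
have := prefix_sum_mrev m kn; have := prefix_sum_mrev c kn.
have := atom_mdeg Af cp; rewrite !mdeg_mrev -mm'; lia.
Qed.

End Reversal.

Theorem mainTheorem7 (n : nat) (p : {mpoly int[n]}) :
  ((exists a : n.-tuple nat, p = demazure_atom a) /\
   (exists b : n.-tuple nat, p = young_atom b)) <->
  (exists a : n.-tuple nat,
     (forall i : 'I_n.-1,
        `| (tnth a (lo i))%:Z - (tnth a (hi i))%:Z | <= 1) /\
     p = young_atom a).
Proof.
have atom_rev (a : n.-tuple nat) : atom (mrev (Multinom a)) (demazure_atom (rev_comp a)).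
  by rewrite mrev_Multinom; apply: demazure_atomP.
split=> [[[a Ea] [b Eb]]|[a [/slow_variationP[up dn] Ep]]].
  have Ap : atom (Multinom a) p by rewrite Ea; apply: demazure_atomP.
  have E c : p@_c = (demazure_atom (rev_comp b))@_(mrev c).
    by rewrite Eb mcoeff_reverse_vars.
  have [Eab pX] := common_atom Ap (atom_rev b) E.
  exists b; split => //; apply/slow_variationP; rewrite -Eab; split.
    by apply: monomial_atom_slow_growth; rewrite -pX.
  apply: monomial_atom_slow_growth.
  have -> : 'X_[mrev (Multinom a)] = demazure_atom (rev_comp b).
    apply/mpolyP => c; rewrite -[c]mrevK -E pX !mcoeffX.
    by rewrite (inj_eq (inv_inj (@mrevK n))).
  by rewrite Eab; apply: atom_rev.
(* The two growth conditions make the Demazure atom of [a] and that of its reversal monomials, which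
   [mrev] exchanges. *)
have Eq : p = demazure_atom a.
  rewrite (slow_growth_atom (demazure_atomP a) up); apply/mpolyP => c.
  rewrite Ep mcoeff_reverse_vars (slow_growth_atom (atom_rev a) dn) !mcoeffX.
  by rewrite (inj_eq (inv_inj (@mrevK n))).
by split; exists a.
Qed.
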